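(* Let $D\in\mathbb{R}^{m\times n}$ have rows indexed by a set $\mathcal{D}$ with $|\mathcal{D}|=m$, let $f^0\in\mathbb{R}^n$, $Y\sim\mathcal{N}_n(f^0,I)$, and let $S\subseteq\mathcal{D}$ be arbitrary with $s:=|S|<m$. Let $\bar{\mathcal{N}}_{-S}$ be any linear space with $\mathcal{N}_{-S}\subseteq\bar{\mathcal{N}}_{-S}\subseteq\mathbb{R}^n$, with dimension $\bar r_S$, and let $\Psi^{-S}=\{\psi_j^{-S}\}_{j\in\mathcal{D}\setminus S}\in\mathbb{R}^{n\times(m-s)}$ be a dictionary for $\bar{\mathcal{N}}_{-S}^{\perp}$. Let $u>0$, $v>0$ and let the tuning parameter $\lambda>0$ satisfy $$\lambda\ge\max_{j\in\mathcal{D}\setminus S}\|\psi_j^{-S}\|_n\,\lambda_0(u),\qquad\lambda_0(u):=\sqrt{\frac{2\log(2(m-s))+2u}{n}}.$$ Then for all $f\in\mathbb{R}^n$ the following bounds hold: (i) (non-adaptive bound) with probability at least $1-e^{-u}-e^{-v}$, $$\|\hat f-f^0\|_n^2\le\|f-f^0\|_n^2+4\lambda\|Df\|_1+\Bigl(\sqrt{\frac{\bar r_S}{n}}+\sqrt{\frac{2v}{n}}\Bigr)^2;$$ (ii) (adaptive bound) with probability at least $1-e^{-u}-e^{-v}$, $$\|\hat f-f^0\|_n^2\le\|f-f^0\|_n^2+4\lambda\|(Df)_{-S}\|_1+\Bigl(\sqrt{\frac{\bar r_S}{n}}+\sqrt{\frac{2v}{n}}+\lambda\,\Gamma(q_S,w_{-S})\Bigr)^2,$$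 where $q_S=\mathrm{sign}(Df)_S\in\{-1,+1\}^s$ and $w_j=\|\psi_j^{-S}\|_n\lambda_0(u)/\lambda$ for $j\in\mathcal{D}\setminus S$.
   Context: For $v\in\mathbb{R}^n$, $\|v\|_n^2:=\frac1n\sum_{i=1}^nv_i^2$. The analysis estimator is $\hat f:=\arg\min_{g\in\mathbb{R}^n}\{\|Y-g\|_n^2+2\lambda\|Dg\|_1\}$ (any minimizer; it is unique). For $b\in\mathbb{R}^m$ indexed by $\mathcal{D}$: $b_S:=\{b_j\}_{j\in S}$, $b_{-S}:=\{b_j\}_{j\in\mathcal{D}\setminus S}$. $\mathcal{N}_{-S}:=\{g\in\mathbb{R}^n:(Dg)_{-S}=0\}$. For $g\in\mathbb{R}^n$, $g_{\bar{\mathcal{N}}_{-S}^{\perp}}$ is the orthogonal projection of $g$ onto the orthocomplement of $\bar{\mathcal{N}}_{-S}$. A dictionary for $\bar{\mathcal N}_{-S}^\perp$ is a matrix $\Psi^{-S}$ with columns $\psi_j^{-S}$, $j\in\mathcal{D}\setminus S$, such that $g_{\bar{\mathcal{N}}_{-S}^{\perp}}=\Psi^{-S}(Dg)_{-S}$ for all $g\in\mathbb{R}^n$. Noisy effective sparsity: for $q_S\in\{-1,+1\}^s$ and weights $w_{-S}=\{w_j\}_{j\in\mathcal{D}\setminus S}$ with $0\le w_j\le1$, $$\Gamma^2(q_S,w_{-S}):=\Bigl(\max\bigl\{q_S'(Dg)_S-\|(1-w_{-S})(Dg)_{-S}\|_1:\ g\in\mathbb{R}^n,\ \|g\|_n=1\bigr\}\Bigr)^2,$$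 where $(1-w_{-S})(Dg)_{-S}:=\{(1-w_j)(Dg)_j\}_{j\in\mathcal{D}\setminus S}$, and $\Gamma(q_S,w_{-S})\ge 0$ is the square root. The sign function takes values in $\{-1,+1\}$, with $\mathrm{sign}(x)x=|x|$ (the value at $0$ being an arbitrary choice in $\{-1,+1\}$), applied entrywise. *)

(* Defs.v *)
From HB Require Import structures.
From mathcomp Require Import all_boot all_order all_algebra.
From mathcomp Require Import all_classical all_reals all_analysis.

Set Implicit Arguments.
Unset Strict Implicit.
Unset Printing Implicit Defensive.

Import Order.TTheory GRing.Theory Num.Theory.
Import numFieldNormedType.Exports.

Local Open Scope classical_set_scope.
Local Open Scope ring_scope.

(* The paper's inner product, empirical norm ||.||_n and l1-norm. The library
   norm `|_| of a vector is the sup norm, so none of these is an instance. *)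
Definition dotp (R : realType) (k : nat) (x y : 'cV[R]_k) : R :=
  \sum_(i < k) x i 0 * y i 0.

Definition sqnormn (R : realType) (n : nat) (x : 'cV[R]_n) : R :=
  n%:R^-1 * \sum_(i < n) x i 0 ^+ 2.

Definition normn (R : realType) (n : nat) (x : 'cV[R]_n) : R :=
  Num.sqrt (sqnormn x).

Definition l1norm (R : realType) (k : nat) (x : 'cV[R]_k) : R :=
  \sum_(i < k) `|x i 0|.

(* b_A, with the elements of A listed in increasing order by enum_val; the
   paper's b_{-S} is [restr (~: S) b], and j in D \ S is an index of type
   'I_#|~: S|. *)
Definition restr (R : realType) (m : nat) (A : {set 'I_m}) (b : 'cV[R]_m) :
    'cV[R]_#|A| :=
  rowsub (fun i : 'I_#|A| => enum_val i) b.

Definition Nminus (R : realType) (m n : nat) (D : 'M[R]_(m, n))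
    (S : {set 'I_m}) : set 'cV[R]_n :=
  [set g | restr (~: S) (D *m g) = 0].

Definition orthocomp (R : realType) (n : nat) (V : {vspace 'cV[R]_n}) :
    set 'cV[R]_n :=
  [set h | forall g, g \in V -> dotp h g = 0].

Definition is_orthoproj (R : realType) (n : nat) (W : set 'cV[R]_n)
    (g p : 'cV[R]_n) : Prop :=
  W p /\ forall h, W h -> dotp (g - p) h = 0.

Definition is_dictionary (R : realType) (m n : nat) (D : 'M[R]_(m, n))
    (S : {set 'I_m}) (V : {vspace 'cV[R]_n}) (Psi : 'M[R]_(n, #|~: S|)) : Prop :=
  forall g : 'cV[R]_n,
    is_orthoproj (orthocomp V) g (Psi *m restr (~: S) (D *m g)).

Definition is_analysis_estimator (R : realType) (m n : nat)
    (D : 'M[R]_(m, n)) (lambda : R) (y fhat : 'cV[R]_n) : Prop :=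
  forall g : 'cV[R]_n,
    sqnormn (y - fhat) + 2 * lambda * l1norm (D *m fhat)
      <= sqnormn (y - g) + 2 * lambda * l1norm (D *m g).

(* The real supremum is the maximum of the paper as soon as 0 < n: a continuous
   function on the (nonempty, compact) unit sphere of ||.||_n attains it. It
   may be negative, in which case Gamma is its absolute value. *)
Definition Gamma2 (R : realType) (m n : nat) (D : 'M[R]_(m, n))
    (S : {set 'I_m}) (q : 'cV[R]_#|S|) (w : 'cV[R]_#|~: S|) : R :=
  (sup [set dotp q (restr S (D *m g))
            - l1norm (\col_j ((1 - w j 0) * restr (~: S) (D *m g) j 0))
       | g in [set g : 'cV[R]_n | normn g = 1]]) ^+ 2.

Definition Gamma (R : realType) (m n : nat) (D : 'M[R]_(m, n))
    (S : {set 'I_m}) (q : 'cV[R]_#|S|) (w : 'cV[R]_#|~: S|) : R :=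
  Num.sqrt (Gamma2 D q w).

Definition is_sign (R : realType) (sgn : R -> R) : Prop :=
  forall x, (sgn x = -1 \/ sgn x = 1) /\ sgn x * x = `|x|.

(* k stands for m - s. *)
Definition lambda0 (R : realType) (n k : nat) (u : R) : R :=
  Num.sqrt ((2 * ln (2 * k%:R) + 2 * u) / n%:R).

Definition randvec d (T : measurableType d) (R : realType)
    (P : probability T R) (n : nat) (Y : 'I_n -> {RV P >-> R}) (t : T) :
    'cV[R]_n :=
  \col_i Y i t.

(* N_n(mu, I): independent coordinates, the i-th one being N(mu_i, 1). The
   product rule for subfamilies of coordinates follows on taking A i = setT. *)
Definition is_normal_id d (T : measurableType d) (R : realType)
    (P : probability T R) (n : nat) (Y : 'I_n -> {RV P >-> R})
    (mu : 'cV[R]_n) : Prop :=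
  (forall (i : 'I_n) (A : set R), measurable A ->
     distribution P (Y i) A = normal_prob (mu i 0) 1 A) /\
  (forall A : 'I_n -> set R, (forall i, measurable (A i)) ->
     P [set t | forall i, A i (Y i t)] = (\prod_(i < n) P (Y i @^-1` A i))%E).

Definition with_prob_ge d (T : measurableType d) (R : realType)
    (P : probability T R) (p : R) (E : set T) : Prop :=
  measurable E /\ (p%:E <= P E)%E.

(* Main.v *)
Require Import Defs.
From HB Require Import structures.
From mathcomp Require Import all_boot all_order all_algebra.
From mathcomp Require Import all_classical all_reals all_analysis.
From mathcomp Require Import measurable_realfun.
From mathcomp Require Import ring lra.

Set Implicit Arguments.
Unset Strict Implicit.
Unset Printing Implicit Defensive.

Import Order.TTheory GRing.Theory Num.Theory.
Import numFieldNormedType.Exports.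

Local Open Scope classical_set_scope.
Local Open Scope ring_scope.

(** Let [eps := Y - f0] be the noise, [h := fhat - f] the error, and [B] an
orthonormal basis of [Nbar].

The objective that [fhat] minimizes is strongly convex, so comparing [fhat] with
[f] gains the extra term [sqnormn h] ([estimator_strong]). Rearranged, this is
[basic_inequality]:

  ||fhat - f0||^2 + ||h||^2
    <= ||f - f0||^2 + 2 <eps, h> / n + 2 lambda (|D f|_1 - |D fhat|_1).

The dictionary splits [h] into its projection on [Nbar] and [Psi (D h)_{-S}]
([dictionary_decomp]), hence [<eps, h>] into two noise terms. By Cauchy-Schwarz,
the first is at most [||h||] times the length of the projected noise. The second
is controlled coordinatewise by the correlations [<psi_j, eps>]
([noise_bound]). The gained [||h||^2] absorbs the terms that are linear in
[||h||], since [2 x c - x^2 <= c^2]. For the nonadaptive bound, what remains of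
the penalties is at most [4 lambda |D f|_1] by the triangle inequality. For the
adaptive one, on [S] the difference of penalties is at most
[q' (D (f - fhat))_S], because [q] is a subgradient of the l1-norm. Off [S] the
noise takes up only the fraction [w_j] of each penalty, and keeping the fraction
[1 - w_j] leaves a homogeneous functional of [f - fhat], at most [||h||] times
its maximum over the unit sphere ([le_normn_Gamma]). Everything up to here is
deterministic.

The two random quantities are bounded by Chernoff's method. For the correlations
one needs the moment generating function of a linear form ([normal_mgf]) and a
union bound over the [m - s] columns and the two signs. For the squared length
of the projected noise, a chi-square variable with [\dim Nbar] degrees of
freedom, one needs the moment generating function of a sum of squares of
orthonormal linear forms ([normal_quadratic_mgf]). It is computed without
rotation invariance or joint densities, by linearizing one square at a time:
[exp (c^2 z^2 / 2)] is the expectation of [exp (c g z)] for [g] standard normal,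
and Tonelli exchanges the expectation over [g] with that over [Y]. Independence,
given as a product rule for events, is extended to nonnegative functions of the
coordinates by the layer-cake formula ([integral_transfer], [indep_prod]).

Finally the events in the theorem are measurable: by strong convexity [fhat] is
a 1-Lipschitz function of [Y] ([estimator_lipschitz]), so their complements are
preimages under [Y] of sets that are open in the range of [Y]. *)

(** * The inner product and the empirical norm *)

Lemma dotpC (R : realType) (n : nat) (x y : 'cV[R]_n) : dotp x y = dotp y x.
Proof. by apply: eq_bigr => i _; rewrite mulrC. Qed.

Lemma dotpDl (R : realType) (n : nat) (x y z : 'cV[R]_n) :
  dotp (x + y) z = dotp x z + dotp y z.
Proof. by rewrite -big_split; apply: eq_bigr => i _; rewrite mxE mulrDl. Qed.

Lemma dotpZl (R : realType) (n : nat) (k : R) (x z : 'cV[R]_n) :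
  dotp (k *: x) z = k * dotp x z.
Proof. by rewrite mulr_sumr; apply: eq_bigr => i _; rewrite mxE mulrA. Qed.

Lemma dotpNl (R : realType) (n : nat) (x z : 'cV[R]_n) :
  dotp (- x) z = - dotp x z.
Proof. by rewrite -scaleN1r dotpZl mulN1r. Qed.

Lemma dotpDr (R : realType) (n : nat) (x y z : 'cV[R]_n) :
  dotp z (x + y) = dotp z x + dotp z y.
Proof. by rewrite dotpC dotpDl !(dotpC z). Qed.

Lemma dotpZr (R : realType) (n : nat) (k : R) (x z : 'cV[R]_n) :
  dotp z (k *: x) = k * dotp z x.
Proof. by rewrite dotpC dotpZl dotpC. Qed.

Lemma dotpNr (R : realType) (n : nat) (x z : 'cV[R]_n) :
  dotp z (- x) = - dotp z x.
Proof. by rewrite dotpC dotpNl dotpC. Qed.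

Lemma dotp0l (R : realType) (n : nat) (z : 'cV[R]_n) : dotp 0 z = 0.
Proof. by rewrite -(scale0r 0) dotpZl mul0r. Qed.

Lemma dotp_suml (R : realType) (n : nat) (I : Type) (s : seq I)
    (F : I -> 'cV[R]_n) (z : 'cV[R]_n) :
  dotp (\sum_(i <- s) F i) z = \sum_(i <- s) dotp (F i) z.
Proof.
elim: s => [|i s IH]; last by rewrite !big_cons dotpDl IH.
by rewrite !big_nil /dotp big1// => i _; rewrite mxE mul0r.
Qed.

Lemma dotp_sumr (R : realType) (n : nat) (I : Type) (s : seq I)
    (F : I -> 'cV[R]_n) (z : 'cV[R]_n) :
  dotp z (\sum_(i <- s) F i) = \sum_(i <- s) dotp z (F i).
Proof. by rewrite dotpC dotp_suml; apply: eq_bigr => i _; rewrite dotpC. Qed.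

Lemma dotp_ge0 (R : realType) (n : nat) (x : 'cV[R]_n) : 0 <= dotp x x.
Proof. by apply: sumr_ge0 => i _; rewrite -expr2 sqr_ge0. Qed.

Lemma dotp_eq0 (R : realType) (n : nat) (x : 'cV[R]_n) : dotp x x = 0 -> x = 0.
Proof.
move=> x0; apply/matrixP => i j; rewrite ord1 [RHS]mxE; apply/eqP.
rewrite -sqrf_eq0; apply/eqP.
have /psumr_eq0P : \sum_(i < n) x i 0 ^+ 2 = 0.
  by rewrite -[RHS]x0; apply: eq_bigr => k _.
by apply => // k _; exact: sqr_ge0.
Qed.

Lemma dotp_CS (R : realType) (n : nat) (x y : 'cV[R]_n) :
  dotp x y ^+ 2 <= dotp x x * dotp y y.
Proof.
have [y0|y0] := eqVneq (dotp y y) 0.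
  by rewrite (dotp_eq0 y0) dotpC !dotp0l expr0n mulr0.
have {}y0 : 0 < dotp y y by rewrite lt_neqAle eq_sym y0 dotp_ge0.
(* The square of the part of [x] orthogonal to [y], cleared of denominators. *)
have := dotp_ge0 (dotp y y *: x - dotp x y *: y).
rewrite !(dotpDl, dotpDr, dotpNl, dotpNr, dotpZl, dotpZr) (dotpC y x).
rewrite (_ : _ + _ = dotp y y * (dotp x x * dotp y y - dotp x y ^+ 2));
  last by ring.
by rewrite pmulr_rge0// subr_ge0.
Qed.

Lemma sqnormnE (R : realType) (n : nat) (x : 'cV[R]_n) :
  sqnormn x = n%:R^-1 * dotp x x.
Proof. by congr (_ * _); apply: eq_bigr => i _. Qed.

Lemma sqnormn_ge0 (R : realType) (n : nat) (x : 'cV[R]_n) : 0 <= sqnormn x.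
Proof. by rewrite sqnormnE mulr_ge0 ?invr_ge0 ?dotp_ge0. Qed.

Lemma normn_ge0 (R : realType) (n : nat) (x : 'cV[R]_n) : 0 <= normn x.
Proof. exact: sqrtr_ge0. Qed.

Lemma sqr_normn (R : realType) (n : nat) (x : 'cV[R]_n) :
  normn x ^+ 2 = sqnormn x.
Proof. by rewrite sqr_sqrtr ?sqnormn_ge0. Qed.

Lemma normnZ (R : realType) (n : nat) (k : R) (x : 'cV[R]_n) :
  0 <= k -> normn (k *: x) = k * normn x.
Proof.
move=> k0; rewrite /normn !sqnormnE dotpZl dotpZr.
rewrite (_ : n%:R^-1 * (k * (k * _)) = k ^+ 2 * (n%:R^-1 * dotp x x));
  last by ring.
by rewrite sqrtrM ?sqr_ge0// sqrtr_sqr ger0_norm.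
Qed.

Lemma normnN (R : realType) (n : nat) (x : 'cV[R]_n) : normn (- x) = normn x.
Proof. by rewrite /normn !sqnormnE dotpNl dotpNr opprK. Qed.

Lemma normn_eq0 (R : realType) (n : nat) (x : 'cV[R]_n) :
  (0 < n)%N -> normn x = 0 -> x = 0.
Proof.
move=> n0 x0; apply: dotp_eq0; have := sqr_normn x.
rewrite x0 expr0n /= sqnormnE => /esym/eqP.
by rewrite mulf_eq0 invr_eq0 pnatr_eq0 (gtn_eqF n0) => /eqP.
Qed.

Lemma dotp_le_normn (R : realType) (n : nat) (x y : 'cV[R]_n) : (0 < n)%N ->
  n%:R^-1 * dotp x y <= normn x * normn y.
Proof.
move=> n0; apply: le_trans (ler_norm _) _.
rewrite -ler_sqr ?nnegrE ?mulr_ge0 ?normn_ge0// real_normK ?num_real//.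
rewrite !exprMn !sqr_normn !sqnormnE.
have := dotp_CS x y; have : 0 < n%:R^-1 :> R by rewrite invr_gt0 ltr0n.
move: (n%:R^-1) => k k0 CS.
rewrite (_ : k * _ * (k * _) = k ^+ 2 * (dotp x x * dotp y y)); last by ring.
by rewrite ler_wpM2l ?sqr_ge0.
Qed.

Lemma normnD (R : realType) (n : nat) (x y : 'cV[R]_n) : (0 < n)%N ->
  normn (x + y) <= normn x + normn y.
Proof.
move=> n0; rewrite -ler_sqr ?nnegrE ?addr_ge0 ?normn_ge0// sqrrD !sqr_normn.
rewrite !sqnormnE dotpDl !dotpDr (dotpC y x) -mulr_natl.
have := dotp_le_normn x y n0; lra.
Qed.

Lemma sqnormn_subZ (R : realType) (n : nat) (r h : 'cV[R]_n) (t : R) :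
  sqnormn (r - t *: h) =
  sqnormn r - 2 * t * (n%:R^-1 * dotp r h) + t ^+ 2 * sqnormn h.
Proof.
rewrite !sqnormnE !(dotpDl, dotpDr, dotpNl, dotpNr, dotpZl, dotpZr) (dotpC h r).
ring.
Qed.

Lemma normn_coord (R : realType) (n : nat) (x : 'cV[R]_n) (i : 'I_n) :
  `|x i 0| <= n%:R * normn x.
Proof.
have n1 : 1 <= n%:R :> R by rewrite ler1n (leq_trans _ (ltn_ord i)).
have n0 : n%:R != 0 :> R by rewrite gt_eqF// (lt_le_trans ltr01).
rewrite -ler_sqr ?nnegrE ?mulr_ge0 ?normn_ge0// real_normK ?num_real//.
rewrite exprMn sqr_normn /sqnormn mulrA expr2 mulfK//.
have : x i 0 ^+ 2 <= \sum_(i < n) x i 0 ^+ 2.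
  by rewrite (bigD1 i)//= lerDl sumr_ge0// => j _; exact: sqr_ge0.
have : 0 <= x i 0 ^+ 2 by exact: sqr_ge0.
nra.
Qed.

Lemma normn_le (R : realType) (n : nat) (x : 'cV[R]_n) (e : R) :
  (0 < n)%N -> 0 <= e -> (forall i, `|x i 0| <= e) -> normn x <= e.
Proof.
move=> n0 e0 xe; rewrite -ler_sqr ?nnegrE ?normn_ge0// sqr_normn /sqnormn.
rewrite ler_pdivrMl ?ltr0n//.
rewrite (_ : n%:R * _ = \sum_(i < n) e ^+ 2); last first.
  by rewrite sumr_const card_ord mulr_natl.
by apply: ler_sum => i _; rewrite -real_normK ?num_real// lerXn2r ?nnegrE.
Qed.

Lemma l1norm_convex (R : realType) (k : nat) (x y : 'cV[R]_k) (t : R) :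
  0 <= t <= 1 ->
  l1norm ((1 - t) *: x + t *: y) <= (1 - t) * l1norm x + t * l1norm y.
Proof.
move=> /andP[t0 t1]; rewrite !mulr_sumr -big_split /=; apply: ler_sum => i _.
rewrite !mxE; apply: le_trans (ler_normD _ _) _.
by rewrite !normrM (ger0_norm t0) (@ger0_norm _ (1 - t)) ?subr_ge0.
Qed.

Lemma l1norm_restr (R : realType) (m : nat) (S : {set 'I_m}) (b : 'cV[R]_m) :
  l1norm b = l1norm (restr S b) + l1norm (restr (~: S) b).
Proof.
rewrite /l1norm (bigID [in S]) /=; congr (_ + _).
  by rewrite big_enum_val; apply: eq_bigr => i _; rewrite !mxE.
rewrite (eq_bigl [in ~: S]) => [|i]; last by rewrite inE.
by rewrite big_enum_val; apply: eq_bigr => i _; rewrite !mxE.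
Qed.

(** * Orthonormal bases and dictionaries *)

Definition dotp_orthonormal (R : realType) (n : nat) (B : seq 'cV[R]_n) :=
  all (fun b => dotp b b == 1) B && pairwise (fun b c => dotp b c == 0) B.

Lemma dotp_orthonormal_sum (R : realType) (n : nat) (B : seq 'cV[R]_n)
    (c : 'cV[R]_n -> R) : dotp_orthonormal B ->
  dotp (\sum_(b <- B) c b *: b) (\sum_(b <- B) c b *: b) =
  \sum_(b <- B) c b ^+ 2.
Proof.
elim: B => [_|b B IH]; first by rewrite !big_nil dotp0l.
rewrite /dotp_orthonormal /= => /andP[/andP[/eqP b1 onB] /andP[/allP bB pB]].
rewrite !big_cons dotpDl !dotpDr IH; last by rewrite /dotp_orthonormal onB.
have b0 : dotp b (\sum_(j <- B) c j *: j) = 0.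
  rewrite dotp_sumr big_seq big1// => j jB.
  by rewrite dotpZr (eqP (bB j jB)) mulr0.
by rewrite [dotp (\sum_(j <- B) _) (c b *: b)]dotpC !dotpZl dotpZr b0 b1; ring.
Qed.

(** Gram-Schmidt, as an induction on the dimension: normalize one vector [v] of
[V] and pass to its orthogonal hyperplane in [V], the kernel of
[x |-> v^T *m x]. *)
Lemma orthonormal_basis (R : realType) (n : nat) (V : {vspace 'cV[R]_n}) :
  exists B : seq 'cV[R]_n, [/\ dotp_orthonormal B, size B = \dim V,
    {subset B <= V} & forall x, x \in V -> x = \sum_(b <- B) dotp b x *: b].
Proof.
move: {2}(\dim V) (erefl (\dim V)) => r; elim: r V => [|r IH] V rV.
  exists [::]; split => // x.
  by move/eqP: rV; rewrite dimv_eq0 => /eqP ->; rewrite memv0 big_nil => /eqP.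
have v0 : dotp (vpick V) (vpick V) != 0.
  apply/eqP => /dotp_eq0/eqP; rewrite vpick0 => /eqP V0.
  by rewrite V0 dimv0 in rV.
pose v := (Num.sqrt (dotp (vpick V) (vpick V)))^-1 *: vpick V.
have vV : v \in V by rewrite memvZ ?memv_pick.
have v1 : dotp v v = 1.
  rewrite dotpZl dotpZr mulrA -expr2 exprVn sqr_sqrtr ?dotp_ge0//.
  by rewrite mulVf.
pose f : 'Hom('cV[R]_n, 'M[R]_1) := linfun (mulmx v^T).
have fE x : f x = (dotp v x)%:M.
  rewrite lfunE /=; apply/matrixP => i j; rewrite !ord1 !mxE eqxx mulr1n.
  by apply: eq_bigr => k _; rewrite !mxE.
have inW x : (x \in (V :&: lker f)%VS) = (x \in V) && (dotp v x == 0).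
  rewrite memv_cap memv_ker fE; congr andb.
  apply/eqP/eqP => [/matrixP/(_ 0 0)|->]; first by rewrite !mxE eqxx mulr1n.
  by apply/matrixP => i j; rewrite !mxE mul0rn.
have dW : \dim (V :&: lker f) = r.
  have := limg_ker_dim f V; rewrite rV.
  suff -> : \dim (f @: V) = 1%N by rewrite addn1 => -[].
  apply/eqP; rewrite eqn_leq; apply/andP; split.
    by rewrite (leq_trans (dimvS (subvf _)))// dimvf dim_matrix.
  rewrite lt0n dimv_eq0; apply/eqP => fV0.
  have := memv_img f vV; rewrite fV0 memv0 fE v1 => /eqP/matrixP/(_ 0 0)/eqP.
  by rewrite !mxE eqxx mulr1n oner_eq0.
have [B [onB sB BV spB]] := IH _ dW.
have vB b : b \in B -> dotp v b = 0.
  by move=> /BV; rewrite inW => /andP[_ /eqP].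
exists (v :: B); split.
- move: onB; rewrite /dotp_orthonormal/= v1 eqxx/= => /andP[-> ->].
  by rewrite andbT/=; apply/allP => b /vB ->.
- by rewrite /= sB dW rV.
- move=> b; rewrite inE => /orP[/eqP -> //|/BV].
  by rewrite inW => /andP[].
move=> x xV; rewrite big_cons.
have xW : x - dotp v x *: v \in (V :&: lker f)%VS.
  by rewrite inW memvB ?(memvZ _ vV)//= dotpDr dotpNr dotpZr v1 mulr1 subrr.
rewrite -[LHS](subrK (dotp v x *: v)) addrC; congr (_ + _).
rewrite [LHS]spB//; apply: eq_big_seq => b bB; congr (_ *: _).
by rewrite dotpDr dotpNr dotpZr [dotp b v]dotpC (vB b bB) mulr0 subr0.
Qed.

Lemma dictionary_decomp (R : realType) (m n : nat) (D : 'M[R]_(m, n))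
    (S : {set 'I_m}) (V : {vspace 'cV[R]_n}) (Psi : 'M[R]_(n, #|~: S|))
    (B : seq 'cV[R]_n) (h : 'cV[R]_n) :
  is_dictionary D V Psi -> dotp_orthonormal B -> {subset B <= V} ->
  (forall x, x \in V -> x = \sum_(b <- B) dotp b x *: b) ->
  h = \sum_(b <- B) dotp b h *: b + Psi *m restr (~: S) (D *m h).
Proof.
move=> /(_ h) [Wp orth] onB BV spB.
(* Both [p] and [h - hN] are the projection of [h] onto the orthocomplement. *)
set p := Psi *m _; set hN := \sum_(b <- B) _.
have Wh : orthocomp V (h - hN).
  move=> g gV; rewrite dotpDl dotpNl {1}(spB g gV) dotp_sumr dotp_suml.
  apply/eqP; rewrite subr_eq0; apply/eqP; apply: eq_bigr => b _.
  by rewrite dotpZr dotpZl mulrC [dotp h b]dotpC.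
have hNV : hN \in V.
  by rewrite /hN big_seq memv_suml// => b bB; rewrite memvZ// BV.
have W' : orthocomp V (h - hN - p).
  by move=> g gV; rewrite dotpDl dotpNl (Wh g gV) (Wp g gV) subr0.
have E : h - hN - p = 0.
  apply: dotp_eq0; rewrite {1}(_ : _ - p = (h - p) - hN); last by rewrite addrAC.
  by rewrite dotpDl dotpNl orth// [dotp hN _]dotpC W'// subr0.
by move/eqP: E; rewrite subr_eq0 subr_eq addrC => /eqP.
Qed.

(** * Strong convexity of the analysis problem *)

(** The limit [t -> 0] of the first-order condition at a minimizer. *)
Lemma ge0_affine_near0 (R : realType) (c d : R) : 0 <= d ->
  (forall t, 0 < t <= 1 -> 0 <= c + t * d) -> 0 <= c.
Proof.
move=> d0 H; rewrite leNgt; apply/negP => c0.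
pose t := - c / (2 * (d - c)).
have dc : 0 < d - c by lra.
have tE : t * (2 * (d - c)) = - c by rewrite divfK// gt_eqF// mulr_gt0.
have t0 : 0 < t by rewrite divr_gt0// ?mulr_gt0// oppr_gt0.
have t1 : t <= 1 by nra.
have := H t; rewrite t0 t1 => /(_ isT); nra.
Qed.

(** At [fh + t *: (f - fh)] the quadratic part of the objective has second-order
term [t ^+ 2 * sqnormn (f - fh)], and the penalty is convex in [t]. Minimality
makes the first-order term at [fh] nonnegative. *)
Lemma estimator_strong (R : realType) (m n : nat) (D : 'M[R]_(m, n))
    (lambda : R) (y fh f : 'cV[R]_n) : 0 <= lambda ->
  is_analysis_estimator D lambda y fh ->
  sqnormn (y - fh) + 2 * lambda * l1norm (D *m fh) + sqnormn (f - fh)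
    <= sqnormn (y - f) + 2 * lambda * l1norm (D *m f).
Proof.
move=> l0 fhP; set h := f - fh; set r := y - fh.
have fE : y - f = r - h by rewrite /r /h opprB addrA subrK.
pose c := - (2 * (n%:R^-1 * dotp r h)) +
  2 * lambda * (l1norm (D *m f) - l1norm (D *m fh)).
suff : 0 <= c.
  rewrite /c fE; have := sqnormn_subZ r h 1; rewrite scale1r => ->; lra.
apply: (@ge0_affine_near0 _ _ (sqnormn h)); first exact: sqnormn_ge0.
move=> t /andP[t0 t1].
(* Minimality along the segment from [fh] to [f]. *)
have := fhP (fh + t *: h).
rewrite opprD addrA -/r sqnormn_subZ.
have -> : D *m (fh + t *: h) = (1 - t) *: (D *m fh) + t *: (D *m f).
  rewrite mulmxDr -scalemxAr mulmxBr scalerBr scalerBl scale1r.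
  by rewrite addrA addrAC.
have := @l1norm_convex _ _ (D *m fh) (D *m f) t; rewrite (ltW t0) t1 => /(_ isT).
move/(ler_wpM2l l0) => H1 H2.
rewrite -(pmulr_rge0 _ t0) /c; nra.
Qed.

(** Adding the strong convexity inequalities at the two data points, tested
against each other, cancels the penalties. Uniqueness of the minimizer and its
continuity in the data follow at once. *)
Lemma estimator_lipschitz (R : realType) (m n : nat) (D : 'M[R]_(m, n))
    (lambda : R) (y1 y2 f1 f2 : 'cV[R]_n) : (0 < n)%N -> 0 <= lambda ->
  is_analysis_estimator D lambda y1 f1 -> is_analysis_estimator D lambda y2 f2 ->
  normn (f1 - f2) <= normn (y1 - y2).
Proof.
move=> n0 l0 H1 H2.
have := estimator_strong f2 l0 H1; have := estimator_strong f1 l0 H2.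
have := dotp_le_normn (y1 - y2) (f1 - f2) n0.
have := sqr_normn (f1 - f2).
have := normn_ge0 (f1 - f2); have := normn_ge0 (y1 - y2).
move: (normn (y1 - y2)) (normn (f1 - f2)) => a b.
rewrite !sqnormnE !(dotpDl, dotpDr, dotpNl, dotpNr).
rewrite (dotpC f2 f1) (dotpC f1 y1) (dotpC f2 y1) (dotpC f1 y2) (dotpC f2 y2).
move=> a0 b0 E C A1 A2.
have : b ^+ 2 <= a * b by lra.
rewrite expr2; have [->//|bn0] := eqVneq b 0.
by rewrite ler_pM2r// lt_neqAle eq_sym bn0.
Qed.

Lemma basic_inequality (R : realType) (m n : nat) (D : 'M[R]_(m, n))
    (lambda : R) (y fh f f0 : 'cV[R]_n) : 0 <= lambda ->
  is_analysis_estimator D lambda y fh ->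
  sqnormn (fh - f0) + sqnormn (fh - f) <= sqnormn (f - f0)
   + 2 * (n%:R^-1 * dotp (y - f0) (fh - f))
   + 2 * lambda * (l1norm (D *m f) - l1norm (D *m fh)).
Proof.
move=> l0 /(estimator_strong f l0).
rewrite !sqnormnE !(dotpDl, dotpDr, dotpNl, dotpNr).
rewrite (dotpC f0 f) (dotpC f0 fh) (dotpC f fh) (dotpC f y) (dotpC fh y).
lra.
Qed.

(** * Deterministic oracle inequalities *)

(** [B] describes the projection onto [V]; the sum of the squares of the
[dotp b eps] is the squared length of the projected noise. *)
Lemma noise_bound (R : realType) (m n : nat) (D : 'M[R]_(m, n))
    (S : {set 'I_m}) (V : {vspace 'cV[R]_n}) (Psi : 'M[R]_(n, #|~: S|))
    (B : seq 'cV[R]_n) (beta : R) (mu : 'I_#|~: S| -> R) (eps h : 'cV[R]_n) :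
  (0 < n)%N -> is_dictionary D V Psi -> dotp_orthonormal B -> {subset B <= V} ->
  (forall x, x \in V -> x = \sum_(b <- B) dotp b x *: b) ->
  0 <= beta -> \sum_(b <- B) dotp b eps ^+ 2 <= n%:R * beta ^+ 2 ->
  (forall j, `|dotp (col j Psi) eps| <= n%:R * mu j) ->
  n%:R^-1 * dotp eps h <=
    beta * normn h + \sum_j mu j * `|restr (~: S) (D *m h) j 0|.
Proof.
move=> n0 dict onB BV spB beta0 Beps Aeps.
have n0' : 0 < n%:R :> R by rewrite ltr0n.
have {1}-> := dictionary_decomp h dict onB BV spB.
set z := restr _ _; rewrite dotpDr mulrDr; apply: lerD.
  pose p := \sum_(b <- B) dotp b eps *: b.
  have -> : dotp eps (\sum_(b <- B) dotp b h *: b) = dotp p h.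
    rewrite dotp_sumr dotp_suml; apply: eq_bigr => b _.
    by rewrite dotpZl dotpZr mulrC (dotpC eps).
  apply: (le_trans (dotp_le_normn _ _ n0)); rewrite ler_wpM2r ?normn_ge0//.
  rewrite -ler_sqr ?nnegrE ?normn_ge0// sqr_normn sqnormnE dotp_orthonormal_sum//.
  by rewrite ler_pdivrMl.
have -> : dotp eps (Psi *m z) = \sum_j z j 0 * dotp (col j Psi) eps.
  rewrite /dotp; under eq_bigr do rewrite mxE mulr_sumr.
  rewrite exchange_big /=; apply: eq_bigr => j _; rewrite mulr_sumr.
  by apply: eq_bigr => i _; rewrite !mxE; ring.
rewrite ler_pdivrMl// mulr_sumr; apply: ler_sum => j _.
apply: (le_trans (ler_norm _)); rewrite normrM mulrA mulrC.
by rewrite ler_wpM2r.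
Qed.

(** The functional whose supremum defines [Gamma] is positively homogeneous.
It is bounded above on the unit sphere because its second term is nonpositive,
the entries of [q] are at most 1 and [D] is a bounded operator. As [Gamma] is the absolute value of the supremum, it
is at least the supremum. *)
Lemma le_normn_Gamma (R : realType) (m n : nat) (D : 'M[R]_(m, n))
    (S : {set 'I_m}) (q : 'cV[R]_#|S|) (w : 'cV[R]_#|~: S|) (g : 'cV[R]_n) :
  (0 < n)%N -> (forall i, `|q i 0| <= 1) ->
  dotp q (restr S (D *m g))
    - l1norm (\col_j ((1 - w j 0) * restr (~: S) (D *m g) j 0))
  <= normn g * Gamma D q w.
Proof.
move=> n0 q1.
pose V (g : 'cV[R]_n) := dotp q (restr S (D *m g))
    - l1norm (\col_j ((1 - w j 0) * restr (~: S) (D *m g) j 0)).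
rewrite -/(V g).
have VZ k g' : 0 <= k -> V (k *: g') = k * V g'.
  move=> k0; rewrite /V -scalemxAr.
  have rZ A : restr A (k *: (D *m g')) = k *: restr A (D *m g').
    by apply/matrixP => i j; rewrite !mxE.
  rewrite !rZ dotpZr mulrBr; congr (_ - _).
  rewrite /l1norm mulr_sumr; apply: eq_bigr => j _.
  by rewrite !mxE mulrCA normrM ger0_norm.
have Vub : has_ubound [set V g | g in [set g : 'cV[R]_n | normn g = 1]].
  exists (\sum_(i < #|S|) \sum_(k < n) `|D (enum_val i) k| * n%:R).
  move=> _ [x /= x1 <-].
  apply: (@le_trans _ _ (dotp q (restr S (D *m x)))).
    by rewrite /V lerBlDr lerDl sumr_ge0.
  apply: ler_sum => i _; apply: (le_trans (ler_norm _)); rewrite normrM.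
  apply: (@le_trans _ _ `|restr S (D *m x) i 0|); first by rewrite ler_piMl.
  rewrite !mxE; apply: (le_trans (ler_norm_sum _ _ _)).
  apply: ler_sum => k _; rewrite normrM ler_wpM2l//.
  by have := normn_coord x k; rewrite x1 mulr1.
have [g0|g0] := eqVneq (normn g) 0.
  rewrite (normn_eq0 n0 g0) -(scale0r 0) VZ// mul0r scale0r.
  by rewrite mulr_ge0 ?normn_ge0 ?sqrtr_ge0.
have {}g0 : 0 < normn g by rewrite lt_neqAle eq_sym g0 normn_ge0.
have -> : V g = normn g * V ((normn g)^-1 *: g).
  by rewrite VZ ?invr_ge0 ?normn_ge0// mulVKf ?gt_eqF.
rewrite ler_pM2l//.
apply: (@le_trans _ _
  (sup [set V g | g in [set g : 'cV[R]_n | normn g = 1]])).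
  apply: ub_le_sup => //; exists ((normn g)^-1 *: g) => //=.
  by rewrite normnZ ?invr_ge0 ?normn_ge0// mulVf ?gt_eqF.
by rewrite /Gamma /Gamma2 sqrtr_sqr ler_norm.
Qed.

Lemma nonadaptive_bound (R : realType) (m n : nat) (D : 'M[R]_(m, n))
    (S : {set 'I_m}) (lambda beta : R) (mu : 'I_#|~: S| -> R)
    (y fh f f0 : 'cV[R]_n) :
  0 <= lambda -> (forall j, mu j <= lambda) ->
  is_analysis_estimator D lambda y fh ->
  n%:R^-1 * dotp (y - f0) (fh - f) <= beta * normn (fh - f)
    + \sum_j mu j * `|restr (~: S) (D *m (fh - f)) j 0| ->
  sqnormn (fh - f0) <=
    sqnormn (f - f0) + 4 * lambda * l1norm (D *m f) + beta ^+ 2.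
Proof.
move=> l0 mul /(basic_inequality f f0 l0) basic noise.
have H1 : \sum_j mu j * `|restr (~: S) (D *m (fh - f)) j 0| <=
    lambda * (l1norm (D *m fh) + l1norm (D *m f)).
  apply: (@le_trans _ _ (lambda * l1norm (restr (~: S) (D *m (fh - f))))).
    by rewrite mulr_sumr; apply: ler_sum => j _; rewrite ler_wpM2r.
  rewrite ler_wpM2l//; apply: (@le_trans _ _ (l1norm (D *m (fh - f)))).
    by rewrite (l1norm_restr S) lerDr sumr_ge0.
  rewrite mulmxBr -big_split; apply: ler_sum => i _ /=.
  by rewrite !mxE; exact: ler_normB.
have := sqr_ge0 (normn (fh - f) - beta); rewrite sqrrB sqr_normn.
lra.
Qed.

(** [G] stands for the effective sparsity: the last hypothesis is what
[le_normn_Gamma] provides for [w_j = mu j / lambda]. *)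
Lemma adaptive_bound (R : realType) (m n : nat) (D : 'M[R]_(m, n))
    (S : {set 'I_m}) (lambda beta : R) (mu : 'I_#|~: S| -> R)
    (y fh f f0 : 'cV[R]_n) (sgn : R -> R) (G : R) :
  0 < lambda -> (forall j, mu j <= lambda) -> is_sign sgn ->
  is_analysis_estimator D lambda y fh ->
  n%:R^-1 * dotp (y - f0) (fh - f) <= beta * normn (fh - f)
    + \sum_j mu j * `|restr (~: S) (D *m (fh - f)) j 0| ->
  dotp (restr S (map_mx sgn (D *m f))) (restr S (D *m (f - fh)))
    - l1norm (\col_j ((1 - mu j / lambda) * restr (~: S) (D *m (f - fh)) j 0))
   <= normn (f - fh) * G ->
  sqnormn (fh - f0) <=
    sqnormn (f - f0) + 4 * lambda * l1norm (restr (~: S) (D *m f))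
    + (beta + lambda * G) ^+ 2.
Proof.
move=> l0 mul sg /(basic_inequality f f0 (ltW l0)) basic noise HG.
set q := restr S (map_mx sgn (D *m f)) in HG.
have HS : l1norm (restr S (D *m f)) - l1norm (restr S (D *m fh)) <=
    dotp q (restr S (D *m (f - fh))).
  rewrite -sumrB; apply: ler_sum => i _; rewrite mulmxBr !mxE.
  move: (\sum_j _) (\sum_j _) => b a.
  have [s1 s2] := sg a; rewrite mulrBr s2 lerD2l lerN2.
  apply: (le_trans (ler_norm _)); rewrite normrM.
  by case: s1 => ->; rewrite ?normrN normr1 mul1r.
have HN : \sum_j mu j * `|restr (~: S) (D *m (fh - f)) j 0| +
    lambda * (l1norm (restr (~: S) (D *m f)) -
              l1norm (restr (~: S) (D *m fh))) <=
   lambda * (2 * l1norm (restr (~: S) (D *m f)) -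
     l1norm (\col_j ((1 - mu j / lambda) *
                     restr (~: S) (D *m (f - fh)) j 0))).
  rewrite -sumrB mulr_sumr -big_split /= mulrBr mulrCA.
  rewrite !mulr_sumr -sumrB; apply: ler_sum => j _.
  rewrite !mulmxBr !mxE; move: (\sum_k _) (\sum_k _) => b a.
  have w1 : 0 <= 1 - mu j / lambda by rewrite subr_ge0 ler_pdivrMr// mul1r.
  rewrite normrM (ger0_norm w1) (distrC b a).
  have -> : lambda * ((1 - mu j / lambda) * `|a - b|) =
      (lambda - mu j) * `|a - b|.
    by field; rewrite gt_eqF.
  have := ler_wpM2l (ltW l0) (ler_normB a b); lra.
rewrite !(l1norm_restr S (D *m f), l1norm_restr S (D *m fh)) in basic.
have {}HS := ler_wpM2l (ltW l0) HS.
have {}HG := ler_wpM2l (ltW l0) HG.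
have E : normn (f - fh) = normn (fh - f) by rewrite -normnN opprB.
rewrite E in HG.
have := sqr_ge0 (normn (fh - f) - (beta + lambda * G)).
rewrite sqrrB sqr_normn.
lra.
Qed.

(** * Integrals of functions of independent variables *)

Lemma measurable_bool_set (d : measure_display) (T : measurableType d)
    (p : T -> bool) : measurable_fun setT p -> measurable [set t | p t].
Proof.
by move=> mp; rewrite -[X in measurable X]setTI; exact: (mp measurableT [set true]).
Qed.

(** The weight [G] makes one statement serve both for densities and for
products with the other factors of an independent family. The bound [0 <= x]
is put into the integrand so that Tonelli applies on the whole line. *)
Lemma layer_cake (R : realType) (d : measure_display) (T : measurableType d)
    (m : {sigma_finite_measure set T -> \bar R}) (G f : T -> R) :
  measurable_fun setT G -> measurable_fun setT f ->
  (forall t, 0 <= G t) -> (forall t, 0 <= f t) ->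
  (\int[m]_t (G t * f t)%:E =
   \int[lebesgue_measure]_(x in [set: R])
     \int[m]_t (G t * (0 <= x < f t)%R%:R)%:E)%E.
Proof.
move=> mG mf G0 f0.
have mI : measurable_fun setT (fun z : T * measurableTypeR R =>
    (0 <= z.2 < f z.1)%R%:R : R).
  have -> : (fun z : T * measurableTypeR R => (0 <= z.2 < f z.1)%R%:R) =
      (\1_([set z | 0 <= z.2 < f z.1]) : _ -> R).
    by apply/funext => z; rewrite indicE mem_setE.
  apply: measurable_indic; apply: measurable_bool_set.
  apply: measurable_and; first exact: measurable_fun_ler.
  by apply: measurable_fun_ltr => //; exact: measurableT_comp mf _.
pose h (z : T * measurableTypeR R) : \bar R :=
  (G z.1 * (0 <= z.2 < f z.1)%R%:R)%:E.
have mh : measurable_fun setT h.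
  apply/measurable_EFinP; apply: measurable_funM => //.
  exact: measurableT_comp mG _.
rewrite -(@fubini_tonelli _ _ _ _ _ m lebesgue_measure h mh); last first.
  by move=> z; rewrite lee_fin mulr_ge0.
apply: eq_integral => t _; rewrite /h /=.
under eq_integral do rewrite EFinM.
rewrite ge0_integralZl_EFin//=; last first.
  by apply/measurable_EFinP; exact: (measurableT_comp mI (pair1_measurable t)).
rewrite EFinM; congr (_ * _)%E.
transitivity (\int[lebesgue_measure]_x (\1_(`[0, f t[%classic : set R) x)%:E)%E.
  rewrite integral_indic//= setIT lebesgue_measure_itv/= lte_fin.
  case: ltP => [_|f0']; first by rewrite oppr0 adde0.
  by apply/eqP; rewrite eqe eq_le f0' f0.
by apply: eq_integral => x _; rewrite indicE mem_setE in_itv.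
Qed.

(** By the layer-cake formula, an integral of [f] against a weighted law depends
only on the masses of the superlevel sets of [f]. This replaces approximation by
simple functions. *)
Lemma integral_transfer (R : realType) (d1 d2 d : measure_display)
    (T1 : measurableType d1) (T2 : measurableType d2) (U : measurableType d)
    (m1 : {sigma_finite_measure set T1 -> \bar R})
    (m2 : {sigma_finite_measure set T2 -> \bar R})
    (G1 : T1 -> R) (G2 : T2 -> R) (X1 : T1 -> U) (X2 : T2 -> U) (f : U -> R) :
  measurable_fun setT G1 -> measurable_fun setT G2 ->
  (forall t, 0 <= G1 t) -> (forall t, 0 <= G2 t) ->
  measurable_fun setT X1 -> measurable_fun setT X2 ->
  measurable_fun setT f -> (forall x, 0 <= f x) ->
  (forall A, measurable A -> \int[m1]_t (G1 t * \1_A (X1 t))%:E =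
     \int[m2]_t (G2 t * \1_A (X2 t))%:E)%E ->
  (\int[m1]_t (G1 t * f (X1 t))%:E = \int[m2]_t (G2 t * f (X2 t))%:E)%E.
Proof.
move=> mG1 mG2 G10 G20 mX1 mX2 mf f0 eqA.
rewrite (layer_cake _ mG1 (measurableT_comp mf mX1) G10 (fun t => f0 _)).
rewrite (layer_cake _ mG2 (measurableT_comp mf mX2) G20 (fun t => f0 _)).
apply: eq_integral => x _.
have E u : (0 <= x < f u)%R%:R = \1_[set u | 0 <= x < f u] u :> R.
  by rewrite indicE mem_setE.
under eq_integral do rewrite /= E.
under [RHS]eq_integral do rewrite /= E.
apply: eqA.
have [x0|x0] := boolP (0 <= x) => /=; last by rewrite set_false.
by apply: measurable_bool_set; exact: measurable_fun_ltr.
Qed.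

Lemma integral_indic_comp (R : realType) (dT : measure_display)
    (T : measurableType dT) (P : probability T R) (X : {RV P >-> R}) (A : set R) :
  measurable A -> (\int[P]_t (\1_A (X t))%:E = P (X @^-1` A))%E.
Proof.
move=> mA; rewrite -[RHS](_ : \int[P]_t (\1_(X @^-1` A) t)%:E = _)%E.
  by apply: eq_integral => t _; rewrite !indicE.
rewrite integral_indic ?setIT//.
by rewrite -[X in measurable X]setTI; apply: measurable_funP.
Qed.

(** If every [f i] is an indicator this is the product rule. Indicators are
replaced by arbitrary functions one coordinate at a time. *)
Lemma indep_prod (R : realType) (dT : measure_display) (T : measurableType dT)
    (P : probability T R) (n : nat) (Y : 'I_n -> {RV P >-> R})
    (f : 'I_n -> R -> R) (c : 'I_n -> R) :
  (forall A : 'I_n -> set R, (forall i, measurable (A i)) ->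
     P [set t | forall i, A i (Y i t)] = (\prod_(i < n) P (Y i @^-1` A i))%E) ->
  (forall i, measurable_fun setT (f i)) -> (forall i y, 0 <= f i y) ->
  (forall i, \int[P]_t (f i (Y i t))%:E = (c i)%:E)%E ->
  (\int[P]_t (\prod_i f i (Y i t))%:E = (\prod_i c i)%:E)%E.
Proof.
move=> ind.
(* Induction on the number [k] of factors that are not indicators. *)
suff H k : forall (f : 'I_n -> R -> R) (c : 'I_n -> R),
  (forall i, measurable_fun setT (f i)) -> (forall i y, 0 <= f i y) ->
  (forall i, \int[P]_t (f i (Y i t))%:E = (c i)%:E)%E ->
  (forall i : 'I_n, (k <= i)%N -> exists2 A : set R, measurable A & f i = \1_A) ->
  (\int[P]_t (\prod_i f i (Y i t))%:E = (\prod_i c i)%:E)%E.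
  by move=> mf f0 fc; apply: (H n) => // i; rewrite leqNgt ltn_ord.
elim: k => [|k IH] {}f {}c mf f0 fc fA.
  have [A AP] : exists A : 'I_n -> set R,
      forall i, measurable (A i) /\ f i = \1_(A i).
    suff : forall i, exists A : set R, measurable A /\ f i = \1_A.
      by case/choice => A AP; exists A.
    by move=> i; have [A mA fE] := fA i (leq0n i); exists A.
  have mA i : measurable (A i) by exact: (AP i).1.
  have cE i : (c i)%:E = P (Y i @^-1` A i).
    by rewrite -fc (AP i).2 integral_indic_comp.
  rewrite -prodEFin; under [RHS]eq_bigr do rewrite cE.
  rewrite -ind//.
  set E := [set t | _].
  rewrite -[RHS](_ : \int[P]_t (\1_E t)%:E = _)%E.
    apply: eq_integral => t _; congr EFin.
    under eq_bigr do rewrite (AP _).2 indicE.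
    rewrite indicE; case: (boolP (t \in E)) => [|/negP tE].
      by move=> /set_mem tE; rewrite big1// => i _; rewrite mem_set//; exact: tE.
    have [i Ai] : exists i, ~ A i (Y i t).
      by apply/existsNP => tA; apply: tE; apply/mem_set.
    by rewrite (bigD1 i)//= memNset// mul0r.
  rewrite integral_indic ?setIT//.
  rewrite [X in measurable X](_ : _ = \bigcap_(i in [set: 'I_n]) Y i @^-1` A i).
    apply: fin_bigcap_measurable => // i _.
    by rewrite -[X in measurable X]setTI; apply: measurable_funP.
  by apply/seteqP; split => t /= tA; [move=> i _|move=> i]; exact: tA.
have [kn|nk] := ltnP k n; last first.
  apply: IH => // i ki.
  by have := leq_trans nk ki; rewrite leqNgt ltn_ord.
pose ko := Ordinal kn.
pose G t := \prod_(i < n | i != ko) f i (Y i t).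
pose C := \prod_(i < n | i != ko) c i.
have c0 i : 0 <= c i.
  by rewrite -lee_fin -fc; apply: integral_ge0 => t _; rewrite lee_fin.
have C0 : 0 <= C by apply: prodr_ge0.
have G0 t : 0 <= G t by apply: prodr_ge0.
have mG : measurable_fun setT G.
  rewrite (_ : G = fun t =>
      \prod_(i < n) if i != ko then f i (Y i t) else 1); last first.
    by apply/funext => t; rewrite /G big_mkcond.
    apply: measurable_prod => i _; case: (i != ko) => //; exact: measurableT_comp.
rewrite (bigD1 ko)//= -/C mulrC EFinM -fc -ge0_integralZl_EFin//; last 2 first.
- by move=> t _; rewrite lee_fin.
- by apply/measurable_EFinP; exact: measurableT_comp.
transitivity (\int[P]_t (G t * f ko (Y ko t))%:E)%E.
  by apply: eq_integral => t _; rewrite (bigD1 ko)//= mulrC.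
under [RHS]eq_integral do rewrite -EFinM.
(* It suffices to treat an indicator in position [ko], which is the case [k]. *)
apply: (@integral_transfer _ _ _ _ _ _ _ P P G (cst C) (Y ko) (Y ko)) => //.
move=> A mA.
pose f' i := if i == ko then \1_A else f i.
pose c' i := if i == ko then fine (P (Y ko @^-1` A)) else c i.
have PE : P (Y ko @^-1` A) = (fine (P (Y ko @^-1` A)))%:E.
  rewrite fineK// fin_num_measure// -[X in measurable X]setTI.
  exact: measurable_funP.
have c'E : \prod_i c' i = fine (P (Y ko @^-1` A)) * C.
  rewrite (bigD1 ko)//= /c' eqxx; congr (_ * _).
  by apply: eq_bigr => i /negbTE ->.
transitivity (\prod_i c' i)%:E.
  rewrite -(IH f').
  - apply: eq_integral => t _; rewrite (bigD1 ko)//= /f' eqxx mulrC.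
    by congr ((_ * _)%:E); apply: eq_bigr => i /negbTE ->.
  - by move=> i; rewrite /f'; case: ifP => // _; exact: measurable_indic.
  - by move=> i y; rewrite /f'; case: ifP => // _; rewrite indicE.
  - move=> i; rewrite /f' /c'; case: eqP => // ->.
    by rewrite integral_indic_comp.
  - move=> i ki; rewrite /f'; case: eqP => [_|/eqP ik]; first by exists A.
    apply: fA; rewrite ltn_neqAle ki andbT; apply: contra ik => /eqP ik.
    by apply/eqP/val_inj.
under [RHS]eq_integral do rewrite EFinM.
rewrite ge0_integralZl_EFin//=.
- by rewrite integral_indic_comp// PE -EFinM c'E mulrC.
- apply/measurable_EFinP.
  have mI : measurable_fun setT (\1_A : R -> R) by exact: measurable_indic.
  exact: measurableT_comp mI _.
Qed.

(** * Moment generating functions of Gaussian vectors *)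

(** Completing the square. A quadratic tilt of the unit-variance normal density
is, up to a constant, the normal density with standard deviation [sig]. Parametrizing by
[sig] rather than by [s] avoids square roots in the constant, and [sig = 1] is
the purely linear tilt. *)
Lemma normal_pdf_tilt (R : realType) (mu sig s d y : R) : 0 < sig ->
  s = (1 - sig ^- 2) / 2 ->
  normal_pdf mu 1 y * expR (s * (y - mu) ^+ 2 + d * (y - mu)) =
  sig * expR (d ^+ 2 * sig ^+ 2 / 2) * normal_pdf (mu + d * sig ^+ 2) sig y.
Proof.
move=> sig0 ->; rewrite !normal_pdfE ?oner_eq0 ?gt_eqF// /=.
have -> : normal_peak 1 = sig * normal_peak sig :> R.
  rewrite /normal_peak expr1n mul1r -mulrnAr sqrtrM ?sqr_ge0// sqrtr_sqr.
  by rewrite gtr0_norm// invfM mulrA divff ?gt_eqF// mul1r.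
rewrite -!mulrA; congr (_ * _); rewrite [RHS]mulrCA; congr (_ * _).
rewrite /normal_fun -!expRD; congr expR.
by field; rewrite gt_eqF.
Qed.

Lemma integral_normal_pdf_tilt (R : realType) (mu sig s d : R) : 0 < sig ->
  s = (1 - sig ^- 2) / 2 ->
  (\int[lebesgue_measure]_y
     (normal_pdf mu 1 y * expR (s * (y - mu) ^+ 2 + d * (y - mu)))%:E =
   (sig * expR (d ^+ 2 * sig ^+ 2 / 2))%:E)%E.
Proof.
move=> sig0 sE.
under eq_integral do rewrite (normal_pdf_tilt _ _ _ sig0 sE) EFinM.
rewrite ge0_integralZl_EFin//=.
- by rewrite integral_normal_pdf mule1.
- by move=> y _; rewrite lee_fin normal_pdf_ge0.
- by apply/measurable_EFinP; exact: measurable_normal_pdf.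
- by rewrite mulr_ge0 ?expR_ge0 ?ltW.
Qed.

Lemma measurable_normal_tilt (R : realType) (mu s d : R) :
  measurable_fun setT (fun g : R =>
    normal_pdf mu 1 g * expR (s * (g - mu) ^+ 2 + d * (g - mu))).
Proof.
apply: measurable_funM; first exact: measurable_normal_pdf.
have mB : measurable_fun setT (fun g : R => g - mu) by exact: measurable_funB.
apply: measurableT_comp => //; apply: measurable_funD; apply: measurable_funM => //.
exact: measurable_funX.
Qed.

Lemma integral_normal (R : realType) (dT : measure_display) (T : measurableType dT)
    (P : probability T R) (X : {RV P >-> R}) (mu : R) (f : R -> R) :
  (forall A : set R, measurable A ->
     distribution P X A = normal_prob mu 1 A) ->
  measurable_fun setT f -> (forall y, 0 <= f y) ->
  (\int[P]_t (f (X t))%:E =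
   \int[lebesgue_measure]_(y in [set: R]) (normal_pdf mu 1 y * f y)%:E)%E.
Proof.
move=> XN mf f0.
transitivity (\int[P]_t (cst 1 t * f (X t))%:E)%E.
  by apply: eq_integral => t _; rewrite mul1r.
apply: (@integral_transfer _ _ _ _ _ _ _ P lebesgue_measure (cst 1)
  (normal_pdf mu 1) X id f) => //.
- exact: measurable_normal_pdf.
- by move=> t; exact: normal_pdf_ge0.
- move=> A mA; transitivity (distribution P X A); last rewrite XN//.
    under eq_integral do rewrite mul1r.
    exact: integral_indic_comp.
  rewrite /normal_prob [LHS]integral_mkcond; apply: eq_integral => y _.
  by rewrite patchE indicE; case: ifP => _; rewrite ?mulr1 ?mulr0.
Qed.

Lemma measurable_dotp_randvec (R : realType) (dT : measure_display)
    (T : measurableType dT) (P : probability T R) (n : nat)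
    (Y : 'I_n -> {RV P >-> R}) (mu a : 'cV[R]_n) :
  measurable_fun setT (fun t => dotp a (randvec Y t - mu)).
Proof.
rewrite /dotp; apply: measurable_sum => i; apply: measurable_funM => //.
by under eq_fun do rewrite !mxE; apply: measurable_funB.
Qed.

Lemma normal_mgf (R : realType) (dT : measure_display)
    (T : measurableType dT) (P : probability T R) (n : nat)
    (Y : 'I_n -> {RV P >-> R}) (mu a : 'cV[R]_n) :
  is_normal_id Y mu ->
  (\int[P]_t (expR (dotp a (randvec Y t - mu)))%:E =
   (expR (dotp a a / 2))%:E)%E.
Proof.
move=> [YN Yind].
pose f (i : 'I_n) (y : R) := expR (a i 0 * (y - mu i 0)).
have mf i : measurable_fun setT (f i).
  apply: measurableT_comp => //; apply: measurable_funM => //.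
  exact: measurable_funB.
rewrite [RHS](_ : _ = (\prod_(i < n) expR (a i 0 ^+ 2 / 2))%:E); last first.
  by rewrite -expR_sum -mulr_suml; congr (expR (_ / 2))%:E; apply: eq_bigr => i.
rewrite -(indep_prod (Y := Y) (f := f))//.
- apply: eq_integral => t _; rewrite -expR_sum; congr (expR _)%:E.
  by apply: eq_bigr => i _; rewrite !mxE.
- by move=> i y; exact: expR_ge0.
move=> i; rewrite (integral_normal (YN i))//; last by move=> y; exact: expR_ge0.
transitivity (\int[lebesgue_measure]_y (normal_pdf (mu i 0) 1 y *
    expR (0 * (y - mu i 0) ^+ 2 + a i 0 * (y - mu i 0)))%:E)%E.
  by apply: eq_integral => y _; rewrite mul0r add0r.
rewrite (@integral_normal_pdf_tilt _ _ 1)//; last first.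
  by rewrite expr1n invr1 subrr mul0r.
by rewrite mul1r expr1n mulr1.
Qed.

(** The linear term [dotp a _] is there for the induction on [B]: linearizing
the square of [dotp b _] with an auxiliary normal variable [g] turns [a] into
[a + (c * g) *: b], with [c ^+ 2 = 1 - sig ^- 2]. Orthogonality of [b] to the
other elements keeps their contribution independent of [g]. *)
Lemma normal_quadratic_mgf (R : realType) (dT : measure_display)
    (T : measurableType dT) (P : probability T R) (n : nat)
    (Y : 'I_n -> {RV P >-> R}) (mu : 'cV[R]_n) (B : seq 'cV[R]_n) (sig : R)
    (a : 'cV[R]_n) :
  is_normal_id Y mu -> dotp_orthonormal B -> 1 <= sig ->
  (\int[P]_t (expR ((1 - sig ^- 2) / 2 *
        (\sum_(b <- B) dotp b (randvec Y t - mu) ^+ 2) +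
      dotp a (randvec Y t - mu)))%:E =
   (sig ^+ size B * expR (dotp a a / 2 +
      (sig ^+ 2 - 1) / 2 * \sum_(b <- B) dotp b a ^+ 2))%:E)%E.
Proof.
move=> YN + sig1; have sig0 : 0 < sig by exact: lt_le_trans sig1.
have sE : 0 <= 1 - sig ^- 2.
  by rewrite subr_ge0 invf_le1 ?exprn_gt0// exprn_ege1.
pose c := Num.sqrt (1 - sig ^- 2).
have cE : c ^+ 2 = 1 - sig ^- 2 by rewrite sqr_sqrtr.
rewrite -cE.
elim: B a => [|b B IH] a.
  move=> _; under eq_integral do rewrite big_nil mulr0 add0r.
  by rewrite normal_mgf// big_nil mulr0 addr0 expr0 mul1r.
rewrite /dotp_orthonormal /= => /andP[/andP[/eqP b1 onB] /andP[bB pB]].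
pose e t := randvec Y t - mu.
have me x : measurable_fun setT (fun t => dotp x (e t)).
  exact: measurable_dotp_randvec.
(* Auxiliary standard normal variable [z.2], linearizing the square of
   [dotp b (e z.1)]. *)
pose h (z : T * measurableTypeR R) : \bar R :=
  (normal_pdf 0 1 z.2 * expR (c ^+ 2 / 2 * (\sum_(b <- B) dotp b (e z.1) ^+ 2)
     + (dotp a (e z.1) + c * z.2 * dotp b (e z.1))))%:E.
have mh : measurable_fun setT h.
  apply/measurable_EFinP; apply: measurable_funM.
    exact: (measurableT_comp (measurable_normal_pdf _ _)).
  apply: measurableT_comp => //; apply: measurable_funD.
    apply: measurable_funM => //; apply: measurable_sum => x.
    by apply: measurable_funX; exact: measurableT_comp (me x) _.
  apply: measurable_funD; first exact: measurableT_comp (me a) _.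
  apply: measurable_funM; last exact: measurableT_comp (me b) _.
  exact: measurable_funM.
transitivity (\int[P]_t \int[lebesgue_measure]_(g in [set: measurableTypeR R])
    h (t, g))%E.
  apply: eq_integral => t _.
  transitivity (\int[lebesgue_measure]_(g in [set: R])
      ((expR (c ^+ 2 / 2 * (\sum_(b <- B) dotp b (e t) ^+ 2) +
          dotp a (e t)))%:E *
       (normal_pdf 0 1 g *
          expR (0 * (g - 0) ^+ 2 + (c * dotp b (e t)) * (g - 0)))%:E))%E;
    last first.
    apply: eq_integral => g _; rewrite /h/= -EFinM; congr EFin.
    rewrite mulrCA -expRD; congr (_ * expR _); ring.
  rewrite ge0_integralZl_EFin//; last 2 first.
  - by move=> g _; rewrite lee_fin mulr_ge0 ?normal_pdf_ge0 ?expR_ge0.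
  - by apply/measurable_EFinP; exact: measurable_normal_tilt.
  rewrite (@integral_normal_pdf_tilt _ _ 1)//; last first.
    by rewrite expr1n invr1 subrr mul0r.
  rewrite -EFinM mul1r -expRD big_cons; congr (expR _)%:E; rewrite /e; ring.
rewrite fubini_tonelli//; last first.
  by move=> z; rewrite lee_fin mulr_ge0 ?normal_pdf_ge0 ?expR_ge0.
transitivity (\int[lebesgue_measure]_(g in [set: R])
  ((sig ^+ size B * expR (dotp a a / 2 + (sig ^+ 2 - 1) / 2 *
      (\sum_(b <- B) dotp b a ^+ 2)))%:E *
   (normal_pdf 0 1 g * expR (c ^+ 2 / 2 * (g - 0) ^+ 2 +
      (c * dotp a b) * (g - 0)))%:E))%E.
  apply: eq_integral => g _; rewrite /h /=.
  under eq_integral do rewrite EFinM.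
  rewrite ge0_integralZl_EFin ?normal_pdf_ge0//; last first.
    apply/measurable_EFinP; apply: measurableT_comp => //.
    apply: measurable_funD; last first.
      by apply: measurable_funD => //; exact: measurable_funM.
    apply: measurable_funM => //; apply: measurable_sum => x.
    exact: measurable_funX.
  under eq_integral do rewrite -(dotpZl (c * g) b) -dotpDl.
  rewrite IH; last by rewrite /dotp_orthonormal onB.
  rewrite [X in _ = X](_ : _ = (normal_pdf 0 1 g * (sig ^+ size B * expR
    ((dotp a a / 2 + (sig ^+ 2 - 1) / 2 * (\sum_(b <- B) dotp b a ^+ 2)) +
     (c ^+ 2 / 2 * (g - 0) ^+ 2 + c * dotp a b * (g - 0)))))%:E); last first.
    by rewrite -EFinM mulrCA -(mulrA (sig ^+ _)) -expRD.
  rewrite EFinM; congr (_ * (_ * expR _)%:E)%E.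
  rewrite (eq_big_seq (fun x => dotp x a ^+ 2)) => [|x xB]; last first.
    by rewrite dotpDr dotpZr [dotp x b]dotpC (eqP (allP bB x xB)) mulr0 addr0.
  by rewrite !dotpDl !dotpDr !dotpZl !dotpZr b1 [dotp b a]dotpC; field.
rewrite ge0_integralZl_EFin//; last 3 first.
- by move=> g _; rewrite lee_fin mulr_ge0 ?normal_pdf_ge0 ?expR_ge0.
- by apply/measurable_EFinP; exact: measurable_normal_tilt.
- by rewrite mulr_ge0 ?expR_ge0 ?exprn_ge0 ?ltW.
rewrite (integral_normal_pdf_tilt _ _ sig0) ?cE// -EFinM big_cons; congr EFin.
rewrite mulrACA -exprSr -expRD; congr (_ * expR _).
by rewrite exprMn cE [dotp b a]dotpC; field; rewrite gt_eqF.
Qed.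

(** * Tail bounds *)

Lemma chernoff_bound (R : realType) (dT : measure_display)
    (T : measurableType dT) (P : probability T R) (X : T -> R) (r a M : R) :
  measurable_fun setT X -> 0 < r ->
  (\int[P]_t (expR (r * X t))%:E = M%:E)%E ->
  (P [set t | (a <= X t)%R] <= (M * expR (- (r * a)))%:E)%E.
Proof.
move=> mX r0 E.
pose Xp : {RV P >-> R} := HB.pack X (isMeasurableFun.Build _ _ _ _ _ mX).
have := @chernoff _ _ _ P Xp r a r0; rewrite EFinM -E.
rewrite /mmt_gen_fun expectation_def /=.
by under eq_integral do rewrite mulrC.
Qed.

Lemma normal_upper_tail (R : realType) (dT : measure_display)
    (T : measurableType dT) (P : probability T R) (n : nat)
    (Y : 'I_n -> {RV P >-> R}) (mu a : 'cV[R]_n) (x : R) :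
  is_normal_id Y mu -> 0 < dotp a a -> 0 < x ->
  (P [set t | (Num.sqrt (dotp a a) * x <= dotp a (randvec Y t - mu))%R]
     <= (expR (- (x ^+ 2 / 2)))%:E)%E.
Proof.
move=> YN a0 x0; set L := Num.sqrt (dotp a a).
have L0 : 0 < L by rewrite sqrtr_gt0.
have LE : dotp a a = L ^+ 2 by rewrite sqr_sqrtr// ltW.
(* [x / L] is the optimal Chernoff parameter. *)
have r0 : 0 < x / L by rewrite divr_gt0.
have -> : expR (- (x ^+ 2 / 2)) =
    expR (x ^+ 2 / 2) * expR (- (x / L * (L * x))).
  by rewrite -expRD; congr expR; field; rewrite gt_eqF.
apply: chernoff_bound => //; first exact: measurable_dotp_randvec.
under eq_integral do rewrite -dotpZl.
rewrite (normal_mgf _ YN) dotpZl dotpZr LE; congr (expR _)%:E.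
by field; rewrite gt_eqF.
Qed.

Lemma normal_tail (R : realType) (dT : measure_display)
    (T : measurableType dT) (P : probability T R) (n : nat)
    (Y : 'I_n -> {RV P >-> R}) (mu a : 'cV[R]_n) (x : R) :
  is_normal_id Y mu -> 0 < x ->
  (P [set t | (Num.sqrt (dotp a a) * x < `|dotp a (randvec Y t - mu)|)%R]
     <= (2 * expR (- (x ^+ 2 / 2)))%:E)%E.
Proof.
move=> YN x0.
have me b := @measurable_dotp_randvec _ _ _ P n Y mu b.
have [a0|a0] := eqVneq (dotp a a) 0.
  rewrite [X in P X](_ : _ = set0) ?measure0 ?lee_fin ?mulr_ge0 ?expR_ge0//.
  apply/seteqP; split => // t /=; rewrite (dotp_eq0 a0).
  by rewrite !dotp0l sqrtr0 mul0r normr0 ltxx.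
have {}a0 : 0 < dotp a a by rewrite lt_neqAle eq_sym a0 dotp_ge0.
have N0 : 0 < dotp (- a) (- a) by rewrite dotpNl dotpNr opprK.
have mU b (c : R) : measurable [set t | c <= dotp b (randvec Y t - mu)].
  by apply: measurable_bool_set; exact: measurable_fun_ler.
apply: (@le_trans _ _ (P (
    [set t | (Num.sqrt (dotp a a) * x <= dotp a (randvec Y t - mu))%R] `|`
    [set t | (Num.sqrt (dotp (- a) (- a)) * x
                <= dotp (- a) (randvec Y t - mu))%R]))).
  apply: le_measure; rewrite ?inE.
  - apply: measurable_bool_set.
    by apply: measurable_fun_ltr => //; exact: measurableT_comp.
  - exact: measurableU.
  - move=> t /=; rewrite dotpNl dotpNr opprK dotpNl ltNge ler_norml negb_and -!ltNge.
    by move=> /orP[H|H]; [right|left]; rewrite ltW// ltrNr.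
apply: (le_trans (measureU2 _ _ _)) => //.
rewrite mulr_natl mulr2n EFinD; apply: leeD; exact: normal_upper_tail.
Qed.

(** With [r = size B] and [c = sqrt (2 * v)], Chernoff's bound is
[sig ^+ r * expR (- r * (sig ^+ 2 - 1) / 2)] at [sig = 1 + c / sqrt r].
Then [ln sig <= c / sqrt r] cancels the linear term of the exponent and leaves
[- c ^+ 2 / 2 = - v]. *)
Lemma chi2_tail (R : realType) (dT : measure_display)
    (T : measurableType dT) (P : probability T R) (n : nat)
    (Y : 'I_n -> {RV P >-> R}) (mu : 'cV[R]_n) (B : seq 'cV[R]_n) (v : R) :
  is_normal_id Y mu -> dotp_orthonormal B -> 0 < v ->
  (P [set t | ((Num.sqrt (size B)%:R + Num.sqrt (2 * v)) ^+ 2 <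
     \sum_(b <- B) dotp b (randvec Y t - mu) ^+ 2)%R]
     <= (expR (- v))%:E)%E.
Proof.
move=> YN onB v0.
have mS : measurable_fun setT
    (fun t => \sum_(b <- B) dotp b (randvec Y t - mu) ^+ 2).
  apply: measurable_sum => b; apply: measurable_funX.
  exact: measurable_dotp_randvec.
have mE : measurable [set t | (Num.sqrt (size B)%:R + Num.sqrt (2 * v)) ^+ 2 <
     \sum_(b <- B) dotp b (randvec Y t - mu) ^+ 2].
  by apply: measurable_bool_set; exact: measurable_fun_ltr.
have [B0|B0] := posnP (size B).
  rewrite [X in P X](_ : _ = set0) ?measure0 ?lee_fin ?expR_ge0//.
  apply/seteqP; split => // t /=; rewrite (size0nil B0) big_nil.
  by rewrite ltNge sqr_ge0.
set rho := Num.sqrt (size B)%:R; set c := Num.sqrt (2 * v).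
have rho0 : 0 < rho by rewrite sqrtr_gt0 ltr0n.
have rhoE : (size B)%:R = rho ^+ 2 by rewrite sqr_sqrtr.
have c0 : 0 < c by rewrite sqrtr_gt0 mulr_gt0.
have cE : c ^+ 2 = 2 * v by rewrite sqr_sqrtr// mulr_ge0// ltW.
(* The standard deviation sending the radius [rho] to [rho + c]: the minimizer
   of the Chernoff bound. *)
pose sig := 1 + c / rho.
have sig1 : 1 < sig by rewrite ltrDl divr_gt0.
have sig0 : 0 < sig by exact: lt_trans sig1.
have s0 : 0 < (1 - sig ^- 2) / 2.
  by rewrite divr_gt0// subr_gt0 invf_lt1 ?exprn_gt0// exprn_egt1.
apply: (@le_trans _ _ (P [set t | ((rho + c) ^+ 2 <=
     \sum_(b <- B) dotp b (randvec Y t - mu) ^+ 2)%R])).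
  apply: le_measure; rewrite ?inE//; last by move=> t /=; exact: ltW.
  by apply: measurable_bool_set; exact: measurable_fun_ler.
apply: (le_trans (chernoff_bound (M := sig ^+ size B) _ mS s0 _)).
  have := normal_quadratic_mgf 0 YN onB (ltW sig1).
  rewrite dotp0l mul0r add0r big1 => [|b _]; last by rewrite dotpC dotp0l expr0n.
  rewrite mulr0 expR0 mulr1 => <-.
  by apply: eq_integral => t _; rewrite dotp0l addr0.
rewrite lee_fin.
(* The only loss: [sig <= expR (c / rho)]. *)
apply: (@le_trans _ _ (expR (c / rho) ^+ size B *
    expR (- ((1 - sig ^- 2) / 2 * (rho + c) ^+ 2)))).
  by rewrite ler_wpM2r ?expR_ge0// lerXn2r ?nnegrE ?expR_ge0 ?expR_ge1Dx// ltW.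
rewrite -expRM_natl -expRD ler_expR rhoE.
have -> : v = c ^+ 2 / 2 by rewrite cE mulrC mulKf.
rewrite le_eqVlt; apply/orP; left; apply/eqP.
have h1 : rho != 0 by rewrite gt_eqF.
have h2 : rho + c != 0 by rewrite gt_eqF// addr_gt0.
by rewrite /sig; field; rewrite h1 h2.
Qed.

Lemma measure_bigsetU_le (R : realType) (dT : measure_display)
    (T : measurableType dT) (P : {measure set T -> \bar R}) (I : Type) (s : seq I)
    (F : I -> set T) : (forall i, measurable (F i)) ->
  (P (\big[setU/set0]_(i <- s) F i) <= \sum_(i <- s) P (F i))%E.
Proof.
move=> mF; elim: s => [|i s IH]; first by rewrite !big_nil measure0.
rewrite !big_cons; apply: (le_trans (measureU2 _ _ _)) => //.
  exact: bigsetU_measurable.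
by rewrite leeD2l.
Qed.

(** The threshold is such that [k] columns times two signs times the Gaussian
tail sum up to exactly [expR (- u)]. *)
Lemma noise_dictionary_event (R : realType) (dT : measure_display)
    (T : measurableType dT) (P : probability T R) (n k : nat)
    (Y : 'I_n -> {RV P >-> R}) (mu : 'cV[R]_n) (Psi : 'M[R]_(n, k)) (u : R) :
  (0 < n)%N -> (0 < k)%N -> is_normal_id Y mu -> 0 < u ->
  exists F : set T, [/\ measurable F, (P F <= (expR (- u))%:E)%E &
    forall t, ~ F t -> forall j, `|dotp (col j Psi) (randvec Y t - mu)|
       <= n%:R * (normn (col j Psi) * lambda0 n k u)].
Proof.
move=> n0 k0 YN u0.
pose x := Num.sqrt (2 * ln (2 * k%:R) + 2 * u).
have k1 : 1 <= k%:R :> R by rewrite ler1n.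
have ln0 : 0 <= ln (2 * k%:R) :> R by rewrite ln_ge0//; lra.
have x0 : 0 < x by rewrite sqrtr_gt0; lra.
pose F j := [set t | Num.sqrt (dotp (col j Psi) (col j Psi)) * x <
  `|dotp (col j Psi) (randvec Y t - mu)|].
have mF j : measurable (F j).
  apply: measurable_bool_set; apply: measurable_fun_ltr => //.
  by apply: measurableT_comp => //; exact: measurable_dotp_randvec.
exists (\big[setU/set0]_j F j); split.
- exact: bigsetU_measurable.
- apply: (le_trans (measure_bigsetU_le _ _ _)) => //.
  apply: (@le_trans _ _ (\sum_(j < k) (2 * expR (- (x ^+ 2 / 2)))%:E)%E).
    by apply: lee_sum => j _; exact: normal_tail.
  rewrite sumEFin lee_fin sumr_const card_ord -(mulr_natr _ k).
  rewrite sqr_sqrtr; last by lra.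
  have hE (a b : R) : - ((2 * a + 2 * b) / 2) = - a + - b by field.
  rewrite hE.
  rewrite expRD expRN lnK ?posrE; last by lra.
  rewrite le_eqVlt; apply/orP; left; apply/eqP; field.
  by rewrite gt_eqF//; lra.
move=> t nF j.
have {}nF : ~ F j t.
  move=> Fj; apply: nF; rewrite -bigcup_seq; exists j => //=.
  by rewrite mem_index_enum.
move/negP: nF; rewrite -leNgt => /le_trans; apply.
rewrite /normn sqnormnE /lambda0 -/x.
have ng : 0 < n%:R :> R by rewrite ltr0n.
rewrite sqrtrM ?invr_ge0 ?ler0n// (sqrtrM (n%:R^-1)); last by lra.
rewrite sqrtrV ?ler0n//.
have {1}-> : n%:R = Num.sqrt n%:R ^+ 2 :> R by rewrite sqr_sqrtr ?ler0n.
have : Num.sqrt n%:R != 0 :> R by rewrite gt_eqF// sqrtr_gt0.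
move: (Num.sqrt n%:R) => s s0; rewrite -/x.
by rewrite le_eqVlt; apply/orP; left; apply/eqP; field.
Qed.

Lemma noise_projection_event (R : realType) (dT : measure_display)
    (T : measurableType dT) (P : probability T R) (n : nat)
    (Y : 'I_n -> {RV P >-> R}) (mu : 'cV[R]_n) (B : seq 'cV[R]_n) (v : R) :
  (0 < n)%N -> is_normal_id Y mu -> dotp_orthonormal B -> 0 < v ->
  exists F : set T, [/\ measurable F, (P F <= (expR (- v))%:E)%E &
    forall t, ~ F t -> \sum_(b <- B) dotp b (randvec Y t - mu) ^+ 2 <=
      n%:R * (Num.sqrt ((size B)%:R / n%:R) + Num.sqrt (2 * v / n%:R)) ^+ 2].
Proof.
move=> n0 YN onB v0; exists [set t |
  (Num.sqrt (size B)%:R + Num.sqrt (2 * v)) ^+ 2 <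
     \sum_(b <- B) dotp b (randvec Y t - mu) ^+ 2]; split.
- apply: measurable_bool_set; apply: measurable_fun_ltr => //.
  apply: measurable_sum => b; apply: measurable_funX.
  exact: measurable_dotp_randvec.
- exact: chi2_tail.
move=> t /negP; rewrite -leNgt => /le_trans; apply.
rewrite !sqrtrM ?ler0n ?mulr_ge0 ?(ltW v0)// -mulrDl exprMn.
rewrite sqr_sqrtr ?invr_ge0 ?ler0n//.
by rewrite mulrCA mulfV ?mulr1// pnatr_eq0 -lt0n.
Qed.

(** * Measurability of the events *)

(** A set that is open for the topology pulled back along [Y] is a countable
union of preimages of rational boxes. *)
Lemma measurable_open_preimage (R : realType) (dT : measure_display)
    (T : measurableType dT) (n : nat) (Y : 'I_n -> T -> R) (E : set T) :
  (forall i, measurable_fun setT (Y i)) ->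
  (forall t, E t -> exists2 e : R, 0 < e &
     forall t', (forall i, `|Y i t' - Y i t| < e) -> E t') ->
  measurable E.
Proof.
move=> mY oE.
pose box (z : {ffun 'I_n -> rat} * rat) : set T :=
  [set t | forall i, `|Y i t - ratr (z.1 i)| < ratr z.2].
pose F z := if `[< box z `<=` E >] then box z else set0.
have mbox z : measurable (box z).
  rewrite (_ : box z = \bigcap_(i in [set: 'I_n])
      [set t | `|Y i t - ratr (z.1 i)| < ratr z.2]).
    apply: fin_bigcap_measurable => // i _.
    apply: measurable_bool_set; apply: measurable_fun_ltr => //.
    by apply: measurableT_comp => //; exact: measurable_funB.
  by apply/seteqP; split => t /= tA; [move=> i _|move=> i]; exact: tA.
rewrite (_ : E = \bigcup_z F z).
  apply: countable_bigcupT_measurable => // z; rewrite /F.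
  by case: ifP.
apply/seteqP; split => [t Et|t [z _]]; last first.
  by rewrite /F; case: asboolP => // zE; exact: zE.
have [e e0 eE] := oE t Et.
have /rat_in_itvoo[r] : (0 : R) < e / 2 by rewrite divr_gt0.
rewrite in_itv /= => /andP[r0 re].
have /choice[q qP] : forall i, exists q : rat, `|Y i t - ratr q| < ratr r.
  move=> i; have /rat_in_itvoo[q] : Y i t - ratr r < Y i t + ratr r by lra.
  by rewrite in_itv /= => /andP[q1 q2]; exists q; rewrite ltr_norml; lra.
exists ([ffun i => q i], r) => //; rewrite /F; case: asboolP => [_ i|[]].
  by rewrite ffunE.
move=> t' bt'; apply: eE => i; have := bt' i; rewrite /= ffunE => H1.
have H2 := qP i; rewrite distrC in H2.
have := ler_distD (ratr (q i)) (Y i t') (Y i t); lra.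
Qed.

Lemma measurable_estimator_event (R : realType) (dT : measure_display)
    (T : measurableType dT) (P : probability T R) (n m : nat) (D : 'M[R]_(m, n))
    (Y : 'I_n -> {RV P >-> R}) (lambda : R) (fhat : T -> 'cV[R]_n)
    (f0 : 'cV[R]_n) (C : R) : (0 < n)%N -> 0 <= lambda ->
  (forall t, is_analysis_estimator D lambda (randvec Y t) (fhat t)) ->
  measurable [set t | sqnormn (fhat t - f0) <= C].
Proof.
move=> n0 l0 fP; rewrite -[X in measurable X]setCK; apply: measurableC.
apply: (@measurable_open_preimage _ _ _ _ Y) => // t /negP.
rewrite -ltNge => Ct.
have [C0|C0] := ltP C 0.
  exists 1 => // t' _; apply/negP; rewrite -ltNge.
  exact: lt_le_trans (sqnormn_ge0 _).
pose d := normn (fhat t - f0) - Num.sqrt C.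
have d0 : 0 < d.
  by rewrite subr_gt0 /normn ltr_sqrt// (le_lt_trans C0).
exists (d / 2) => [|t' YY]; first by rewrite divr_gt0.
apply/negP; rewrite -ltNge.
have H1 : normn (fhat t - fhat t') <= d / 2.
  apply: (le_trans (estimator_lipschitz n0 l0 (fP t) (fP t'))).
  apply: normn_le => //; first by rewrite divr_ge0// ltW.
  by move=> i; rewrite !mxE distrC ltW.
have H2 : normn (fhat t - f0) <= normn (fhat t - fhat t') + normn (fhat t' - f0).
  by apply: le_trans (normnD _ _ n0); rewrite addrA subrK.
have H3 : Num.sqrt C < normn (fhat t' - f0) by rewrite /d in H1 d0; lra.
by rewrite -ltr_sqrt ?(sqrtr_gt0 _)// -sqrtr_gt0 (le_lt_trans _ H3) ?sqrtr_ge0.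
Qed.

Lemma with_prob_ge_complement (R : realType) (dT : measure_display)
    (T : measurableType dT) (P : probability T R) (E F1 F2 : set T) (e1 e2 : R) :
  measurable E -> measurable F1 -> measurable F2 ->
  (P F1 <= e1%:E)%E -> (P F2 <= e2%:E)%E ->
  (forall t, ~ F1 t -> ~ F2 t -> E t) ->
  with_prob_ge P (1 - e1 - e2) E.
Proof.
move=> mE mF1 mF2 P1 P2 FE; split=> //.
have mU : measurable (F1 `|` F2) by exact: measurableU.
apply: (@le_trans _ _ (P (~` (F1 `|` F2)))); last first.
  apply: le_measure; rewrite ?inE//; first exact: measurableC.
  by move=> t /= /not_orP[] H1 H2; exact: FE.
rewrite probability_setC//.
have : (P (F1 `|` F2) <= (e1 + e2)%:E)%E.
  by apply: (le_trans (measureU2 _ _ _)) => //; rewrite EFinD leeD.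
rewrite -(fineK (fin_num_measure P _ mU)); move: (fine _) => p.
by rewrite -EFinB !lee_fin => pe; lra.
Qed.

(** * The oracle inequalities with high probability *)

Theorem theorem2p2 (R : realType) (d : measure_display) (T : measurableType d)
    (P : probability T R) (n m : nat) (D : 'M[R]_(m, n)) (f0 : 'cV[R]_n)
    (Y : 'I_n -> {RV P >-> R}) (S : {set 'I_m}) (Nbar : {vspace 'cV[R]_n})
    (Psi : 'M[R]_(n, #|~: S|)) (u v lambda : R) (fhat : T -> 'cV[R]_n)
    (sgn : R -> R)
    (n_gt0 : (0 < n)%N)
    (Y_normal : is_normal_id Y f0)
    (S_lt : (#|S| < m)%N)
    (sub_Nbar : forall g : 'cV[R]_n, Nminus D S g -> g \in Nbar)
    (Psi_dict : is_dictionary D Nbar Psi)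
    (u_gt0 : 0 < u) (v_gt0 : 0 < v) (lambda_gt0 : 0 < lambda)
    (lambda_ge : (\big[Num.max/0]_(j < #|~: S|) normn (col j Psi))
                 * lambda0 n (m - #|S|) u <= lambda)
    (fhat_min : forall t : T,
       is_analysis_estimator D lambda (randvec Y t) (fhat t))
    (sgn_sign : is_sign sgn) :
  forall f : 'cV[R]_n,
    with_prob_ge P (1 - expR (- u) - expR (- v))
      [set t | sqnormn (fhat t - f0) <=
         sqnormn (f - f0) + 4 * lambda * l1norm (D *m f)
         + (Num.sqrt ((\dim Nbar)%:R / n%:R) + Num.sqrt (2 * v / n%:R)) ^+ 2]
    /\
    (let q : 'cV[R]_#|S| := restr S (map_mx sgn (D *m f)) in
     let w : 'cV[R]_#|~: S| :=
       \col_j (normn (col j Psi) * lambda0 n (m - #|S|) u / lambda) in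
     with_prob_ge P (1 - expR (- u) - expR (- v))
       [set t | sqnormn (fhat t - f0) <=
          sqnormn (f - f0) + 4 * lambda * l1norm (restr (~: S) (D *m f))
          + (Num.sqrt ((\dim Nbar)%:R / n%:R) + Num.sqrt (2 * v / n%:R)
             + lambda * Gamma D q w) ^+ 2]).
Proof.
move=> f.
have kE : (m - #|S|)%N = #|~: S| by rewrite [in RHS]cardsCs finset.setCK card_ord.
have k0 : (0 < #|~: S|)%N by rewrite -kE subn_gt0.
rewrite kE in lambda_ge *.
pose mu j := normn (col j Psi) * lambda0 n #|~: S| u.
have mul j : mu j <= lambda.
  apply: le_trans lambda_ge; rewrite ler_wpM2r ?sqrtr_ge0//.
  exact: (le_bigmax _ (fun j => normn (col j Psi))).
have [B [onB sB BV spB]] := orthonormal_basis Nbar.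
have [F1 [mF1 P1 H1]] := noise_dictionary_event Psi n_gt0 k0 Y_normal u_gt0.
have [F2 [mF2 P2 H2]] := noise_projection_event n_gt0 Y_normal onB v_gt0.
rewrite sB in H2; set beta := Num.sqrt _ + Num.sqrt _ in H2 *.
have noise t : ~ F1 t -> ~ F2 t ->
    n%:R^-1 * dotp (randvec Y t - f0) (fhat t - f) <= beta * normn (fhat t - f)
    + \sum_j mu j * `|restr (~: S) (D *m (fhat t - f)) j 0|.
  move=> nF1 nF2; apply: (noise_bound _ n_gt0 Psi_dict onB BV spB).
  - by rewrite addr_ge0 ?sqrtr_ge0.
  - exact: H2.
  - exact: H1.
have lambda_ge0 := ltW lambda_gt0.
split; [|move=> q w].
  apply: (with_prob_ge_complement _ mF1 mF2 P1 P2).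
    exact: measurable_estimator_event fhat_min.
  move=> t nF1 nF2 /=.
  by apply: (nonadaptive_bound lambda_ge0 mul (fhat_min t)); exact: noise.
apply: (with_prob_ge_complement _ mF1 mF2 P1 P2).
  exact: measurable_estimator_event fhat_min.
move=> t nF1 nF2 /=.
apply: (adaptive_bound lambda_gt0 mul sgn_sign (fhat_min t) (noise t nF1 nF2)).
rewrite -/q (_ : (\col_j _) =
  \col_j ((1 - w j 0) * restr (~: S) (D *m (f - fhat t)) j 0)).
  apply: le_normn_Gamma => // i; rewrite !mxE.
  case: (sgn_sign (\sum_j D (enum_val i) j * f j 0)) => -[->|->] _;
    by rewrite ?normrN normr1.
by apply/matrixP => i j; rewrite !mxE.
Qed.
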